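(* Let the system, box constraint sets $\mathbb{X},\mathbb{U}$, stage cost, value functions $V_N$ and gain matrix $K$ be as in the context; in particular assume that there exists $p\in\mathbb{R}^n_{>0}$ with $s+\sum_{i=1}^n\min\{r_i+B_i^\top p,0\}e_i=0$. Let $$\lambda\in L:=\{\lambda\in(0,1]^n : K\Lambda\bar x\le\bar u\ \text{ and }\ BK\Lambda\bar x\le0\},\qquad \Lambda=\operatorname{diag}(\lambda),$$ and let $\hat p=-(BK)^{-\top}(\Lambda^{-1}s+K^\top r)\in\mathbb{R}^n_{>0}$. Then, with $$\gamma=\max\{\hat p_i/s_i : i\in\mathcal{V}\}>0,$$ one has for every $N\in\mathbb{N}$ and every $x\in\mathbb{X}$ $$V_N(x)\le\gamma\, s^\top x .$$
   Context: Notation: $\mathbb{N}$ is the set of positive integers, inequalities between vectors are element-wise, $\mathbf{1}$ is the all-ones vector, $e_i$ is the $i$-th canonical basis vector of $\mathbb{R}^n$, and $M^{-\top}=(M^{-1})^\top$. (The matrix $BK$ below is invertible.) System. Consider a directed graph with vertices $\mathcal{V}=\{1,\dots,n\}$ and an additional goal vertex $g=n+1$. Vertex $i\in\mathcal{V}$ has $m_i$ outgoing edges, each leading to a successor vertex $j\in(\mathcal{V}\cup\{g\})\setminus\{i\}$; $m=\sum_i m_i$. The matrix $B=(B_1\ \cdots\ B_n)\in\mathbb{R}^{n\times m}$ has blocks $B_i\in\mathbb{R}^{n\times m_i}$ with one column per outgoing edge of $i$ (ordered by the label of the successor): the column for edge $(i,j)$ with $j\in\mathcal{V}$ has entry $-1$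 in row $i$, entry $1$ in row $j$, and zeros elsewhere; the column for edge $(i,g)$ has entry $-1$ in row $i$ and zeros elsewhere. The dynamics are $x(t+1)=x(t)+Bu(t)$ with $x(t)\in\mathbb{R}^n_{\ge0}$, $u(t)\in\mathbb{R}^m_{\ge0}$. Vectors in $\mathbb{R}^m$ are partitioned as $u=(u_1,\dots,u_n)$ with $u_i\in\mathbb{R}^{m_i}$. Constraints. For $x\in\mathbb{R}^n_{\ge0}$ let $U(x)=\{u\in\mathbb{R}^m_{\ge0} : \mathbf{1}^\top u_i\le x_i\ \text{for all } i\in\mathcal{V}\}$. For given bounds $\bar x\in\mathbb{R}^n_{>0}$, $\bar u\in\mathbb{R}^m_{>0}$ let $\mathbb{X}=\{x\in\mathbb{R}^n_{\ge0}: x\le\bar x\}$, $\mathbb{U}=\{u\in\mathbb{R}^m_{\ge0}: u\le\bar u\}$, $\mathbb{U}(x)=U(x)\cap\mathbb{U}$. For a control sequence $u$ and initial state $x_0$, $x_u(\cdot,x_0)$ is the trajectory $x_u(0,x_0)=x_0$, $x_u(t+1,x_0)=x_u(t,x_0)+Bu(t)$. For $x_0\in\mathbb{X}$ and $N\in\mathbb{N}$, $\mathbb{U}^N(x_0)$ is the set of $u:\{0,\dots,N-1\}\to\mathbb{R}^m_{\ge0}$ such that $x_u(t,x_0)\in\mathbb{X}$ and $u(t)\in\mathbb{U}(x_u(t,x_0))$ for $t=0,\dots,N-1$, and $x_u(N,x_0)\in\mathbb{X}$. Costs. The stage cost is $\ell(x,u)=s^\top x+r^\top u$ with given $s\in\mathbb{R}^n_{>0}$,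 $r=(r_1,\dots,r_n)\in\mathbb{R}^m_{\ge0}$; $J_N(x_0,u)=\sum_{t=0}^{N-1}\ell(x_u(t,x_0),u(t))$ and $V_N(x_0)=\inf\{J_N(x_0,u):u\in\mathbb{U}^N(x_0)\}$. Gain matrix $K$. In the condition on $p$, $\min\{r_i+B_i^\top p,0\}$ denotes the smallest number among the entries of the vector $r_i+B_i^\top p\in\mathbb{R}^{m_i}$ and $0$. Fix such a $p$. For each $i\in\mathcal{V}$ let $k$ be the first index of a minimal entry of $r_i+B_i^\top p$, and let $K_i\in\mathbb{R}^{m_i\times n}$ be the matrix whose $k$-th row is $e_i^\top$ and whose other rows are zero. Then $K=\begin{pmatrix}K_1^\top&\cdots&K_n^\top\end{pmatrix}^\top\in\mathbb{R}^{m\times n}$. *)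

(* Defs.v *)
From HB Require Import structures.
From mathcomp Require Import all_boot all_order all_algebra.
From mathcomp Require Import all_classical all_reals all_analysis.

Set Implicit Arguments.
Unset Strict Implicit.
Unset Printing Implicit Defensive.

Import Order.TTheory GRing.Theory Num.Theory.

Local Open Scope classical_set_scope.
Local Open Scope ring_scope.

Definition le_mx (R : realType) (a b : nat) (A B : 'M[R]_(a, b)) : Prop :=
  forall i j, A i j <= B i j.

Definition lt_mx (R : realType) (a b : nat) (A B : 'M[R]_(a, b)) : Prop :=
  forall i j, A i j < B i j.

Definition dot (R : realType) (k : nat) (a b : 'cV[R]_k) : R :=
  (a^T *m b) 0 0.

Definition min_entry0 (R : realType) (k : nat) (v : 'cV[R]_k) : R :=
  \big[Num.min/0]_(c < k) v c 0.

(* The neutral value is itself an entry, so this is the largest entry. *)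
Definition max_entry (R : realType) (k : nat) (v : 'cV[R]_k.+1) : R :=
  \big[Num.max/v 0 0]_(c < k.+1) v c 0.

Definition first_argmin (R : realType) (k : nat) (v : 'cV[R]_k) (a : 'I_k) :
    bool :=
  [forall b, v a 0 <= v b 0] && [forall b : 'I_k, (b < a)%N ==> (v a 0 < v b 0)].

(* The vertices 1, ..., n are the elements of ['I_n]; ['I_n.+1] is the vertex
   set with the goal added, the goal being the last element [ord_max].  The
   graph is given by the successor sets [E i : {set 'I_n.+1}]. *)
Definition inV (n : nat) (i : 'I_n) : 'I_n.+1 := widen_ord (leqnSn n) i.

Definition no_loops (n : nat) (E : 'I_n -> {set 'I_n.+1}) : Prop :=
  forall i, inV i \notin E i.

Definition nedges (n : nat) (E : 'I_n -> {set 'I_n.+1}) : nat :=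
  (\sum_(i < n) #|E i|)%N.

(* [u_i], the block of [u] for the edges leaving [i]. *)
Definition blk (R : realType) (n : nat) (E : 'I_n -> {set 'I_n.+1})
    (u : 'cV[R]_(nedges E)) (i : 'I_n) : 'cV[R]_(#|E i|) :=
  submxcol (p_ := fun i => #|E i|) u i.

(* [enum_val] lists the successors in increasing order; when the successor is
   the goal, [enum_val c == inV k] never holds. *)
Definition Bblk (R : realType) (n : nat) (E : 'I_n -> {set 'I_n.+1})
    (i : 'I_n) : 'M[R]_(n, #|E i|) :=
  \matrix_(k < n, c < #|E i|) ((enum_val c == inV k)%:R - (k == i)%:R).

Definition Bmat (R : realType) (n : nat) (E : 'I_n -> {set 'I_n.+1}) :
    'M[R]_(n, nedges E) :=
  \mxrow_(i < n) Bblk R E i.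

Definition reduced_cost (R : realType) (n : nat) (E : 'I_n -> {set 'I_n.+1})
    (r : 'cV[R]_(nedges E)) (p : 'cV[R]_n) (i : 'I_n) : 'cV[R]_(#|E i|) :=
  blk r i + (Bblk R E i)^T *m p.

Definition p_condition (R : realType) (n : nat) (E : 'I_n -> {set 'I_n.+1})
    (s : 'cV[R]_n) (r : 'cV[R]_(nedges E)) (p : 'cV[R]_n) : Prop :=
  s + \sum_(i < n) min_entry0 (reduced_cost r p i) *: delta_mx i 0 = 0.

Definition Kblk (R : realType) (n : nat) (E : 'I_n -> {set 'I_n.+1})
    (r : 'cV[R]_(nedges E)) (p : 'cV[R]_n) (i : 'I_n) : 'M[R]_(#|E i|, n) :=
  \matrix_(a < #|E i|, b < n)
    (first_argmin (reduced_cost r p i) a && (b == i))%:R.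

Definition Kmat (R : realType) (n : nat) (E : 'I_n -> {set 'I_n.+1})
    (r : 'cV[R]_(nedges E)) (p : 'cV[R]_n) : 'M[R]_(nedges E, n) :=
  \mxcol_(i < n) Kblk r p i.

Definition Xbox (R : realType) (n : nat) (xbar : 'cV[R]_n) : set 'cV[R]_n :=
  [set x | le_mx 0 x /\ le_mx x xbar].

Definition Ubox (R : realType) (n : nat) (E : 'I_n -> {set 'I_n.+1})
    (ubar : 'cV[R]_(nedges E)) : set 'cV[R]_(nedges E) :=
  [set u | le_mx 0 u /\ le_mx u ubar].

Definition Uflow (R : realType) (n : nat) (E : 'I_n -> {set 'I_n.+1})
    (x : 'cV[R]_n) : set 'cV[R]_(nedges E) :=
  [set u | le_mx 0 u /\ forall i, dot (const_mx 1) (blk u i) <= x i 0].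

Definition Uadm (R : realType) (n : nat) (E : 'I_n -> {set 'I_n.+1})
    (ubar : 'cV[R]_(nedges E)) (x : 'cV[R]_n) : set 'cV[R]_(nedges E) :=
  @Uflow R n E x `&` Ubox ubar.

(* Control sequences are functions on [nat]; with horizon [N] only the values
   at times [t < N] are constrained or used. *)
Fixpoint traj (R : realType) (n : nat) (E : 'I_n -> {set 'I_n.+1})
    (u : nat -> 'cV[R]_(nedges E)) (x0 : 'cV[R]_n) (t : nat) : 'cV[R]_n :=
  if t is t'.+1 then traj u x0 t' + Bmat R E *m u t' else x0.

Definition UN (R : realType) (n : nat) (E : 'I_n -> {set 'I_n.+1})
    (xbar : 'cV[R]_n) (ubar : 'cV[R]_(nedges E)) (N : nat) (x0 : 'cV[R]_n) :
    set (nat -> 'cV[R]_(nedges E)) :=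
  [set u | (forall t, (t < N)%N ->
              Xbox xbar (traj u x0 t) /\ Uadm ubar (traj u x0 t) (u t))
           /\ Xbox xbar (traj u x0 N)].

Definition stage_cost (R : realType) (n : nat) (E : 'I_n -> {set 'I_n.+1})
    (s : 'cV[R]_n) (r : 'cV[R]_(nedges E))
    (x : 'cV[R]_n) (u : 'cV[R]_(nedges E)) : R :=
  dot s x + dot r u.

Definition J (R : realType) (n : nat) (E : 'I_n -> {set 'I_n.+1})
    (s : 'cV[R]_n) (r : 'cV[R]_(nedges E)) (N : nat) (x0 : 'cV[R]_n)
    (u : nat -> 'cV[R]_(nedges E)) : R :=
  \sum_(0 <= t < N) stage_cost s r (traj u x0 t) (u t).

(* Infimum in the extended reals, so that an empty [UN] would give [+oo]. *)
Definition V (R : realType) (n : nat) (E : 'I_n -> {set 'I_n.+1})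
    (xbar : 'cV[R]_n) (ubar : 'cV[R]_(nedges E))
    (s : 'cV[R]_n) (r : 'cV[R]_(nedges E)) (N : nat) (x0 : 'cV[R]_n) : \bar R :=
  ereal_inf [set (J s r N x0 u)%:E | u in UN xbar ubar N x0].

Definition diagc (R : realType) (n : nat) (v : 'cV[R]_n) : 'M[R]_n :=
  diag_mx v^T.

Definition Lset (R : realType) (n : nat) (E : 'I_n -> {set 'I_n.+1})
    (xbar : 'cV[R]_n) (ubar : 'cV[R]_(nedges E))
    (K : 'M[R]_(nedges E, n)) : set 'cV[R]_n :=
  [set lam | [/\ lt_mx 0 lam, le_mx lam (const_mx 1),
     le_mx (K *m diagc lam *m xbar) ubar &
     le_mx (Bmat R E *m K *m diagc lam *m xbar) 0]].

(* Main.v *)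
Require Import Defs.
From HB Require Import structures.
From mathcomp Require Import all_boot all_order all_algebra.
From mathcomp Require Import all_classical all_reals all_analysis.
From mathcomp Require Import ring lra.

Set Implicit Arguments.
Unset Strict Implicit.
Unset Printing Implicit Defensive.

Import Order.TTheory GRing.Theory Num.Theory.

Local Open Scope ring_scope.

(** The bound is the cost of one explicit controller, the linear feedback
    u = K Lambda x, which sends the fraction lambda_i of the content of vertex
    i along the edge selected by K.

    Write A = - (BK)^T.  Its off-diagonal entries are nonpositive, because an
    edge only adds to its successor, and A p is positive: its i-th entry is the
    edge cost r at the selected edge minus the reduced cost there, and the
    condition on p makes that reduced cost negative.  A matrix of this sign
    pattern that maps some positive vector to a positive vector is inverse
    positive ([Zmx_monotone]); hence BK is invertible, and phat, the solution of
    A phat = Lambda^-1 s + K^T r, is positive.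

    The feedback is admissible because the closed-loop matrix 1 + BK Lambda is
    nonnegative: the order is preserved along trajectories, and the bound xbar
    is mapped below itself since BK Lambda xbar <= 0 ([closed_loop_Xbox]).
    Along the closed loop the stage cost is exactly the decrease of the linear
    function phat^T x, since phat^T BK Lambda x = - s^T x - r^T K Lambda x
    ([phat_decrease]).  The costs telescope, so the total cost is at most
    phat^T x, which is at most gamma s^T x by the definition of gamma. *)

(** * Entrywise order and the dot product *)

(** [mxE] also expands matrix products; the next three lemmas leave them
    folded. *)
Lemma mx0E (R : realType) a b i j : (0 : 'M[R]_(a, b)) i j = 0.
Proof. exact: mxE. Qed.

Lemma mxDE (R : realType) a b (M N : 'M[R]_(a, b)) i j :
  (M + N) i j = M i j + N i j.
Proof. exact: mxE. Qed.

Lemma mxNE (R : realType) a b (M : 'M[R]_(a, b)) i j : (- M) i j = - M i j.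
Proof. exact: mxE. Qed.

Lemma mulmx_ge0 (R : realType) a b c (M : 'M[R]_(a, b)) (N : 'M[R]_(b, c)) :
  le_mx 0 M -> le_mx 0 N -> le_mx 0 (M *m N).
Proof.
move=> M0 N0 i j; rewrite !mxE sumr_ge0 // => k _; apply: mulr_ge0.
  by have := M0 i k; rewrite mxE.
by have := N0 k j; rewrite mxE.
Qed.

Lemma mulmx_le (R : realType) a b c (M : 'M[R]_(a, b)) (N P : 'M[R]_(b, c)) :
  le_mx 0 M -> le_mx N P -> le_mx (M *m N) (M *m P).
Proof.
move=> M0 NP i j; rewrite !mxE ler_sum // => k _.
by rewrite ler_wpM2l //; have := M0 i k; rewrite mxE.
Qed.

Lemma le_mx_trans (R : realType) a b (M N P : 'M[R]_(a, b)) :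
  le_mx M N -> le_mx N P -> le_mx M P.
Proof. by move=> MN NP i j; exact: le_trans (MN i j) (NP i j). Qed.

Lemma dotE (R : realType) k (a b : 'cV[R]_k) :
  dot a b = \sum_i a i 0 * b i 0.
Proof. by rewrite /dot mxE; apply: eq_bigr => i _; rewrite mxE. Qed.

Lemma dotDl (R : realType) k (a b c : 'cV[R]_k) :
  dot (a + b) c = dot a c + dot b c.
Proof. by rewrite /dot linearD mulmxDl mxE. Qed.

Lemma dotDr (R : realType) k (a b c : 'cV[R]_k) :
  dot a (b + c) = dot a b + dot a c.
Proof. by rewrite /dot mulmxDr mxE. Qed.

Lemma dot_mulmx (R : realType) k l (M : 'M[R]_(k, l)) a b :
  dot a (M *m b) = dot (M^T *m a) b.
Proof. by rewrite /dot trmx_mul trmxK mulmxA. Qed.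

Lemma diagcE (R : realType) n (d x : 'cV[R]_n) i :
  (diagc d *m x) i 0 = d i 0 * x i 0.
Proof. by rewrite /diagc mul_diag_mx !mxE. Qed.

Lemma diagc_unit (R : realType) n (d : 'cV[R]_n) :
  lt_mx 0 d -> diagc d \in unitmx.
Proof.
move=> d0; rewrite unitmxE det_diag unitfE; apply/prodf_neq0 => i _.
by have := d0 i 0; rewrite !mxE => /lt0r_neq0.
Qed.

(** * Matrices with nonpositive off-diagonal entries *)

(** Let i minimise v_i / p_i and let c be that minimum.  If c < 0, then v - c p
    is nonnegative and vanishes at i, so the sign pattern of A makes
    (A (v - c p))_i nonpositive, whereas A v - c A p is positive. *)
Lemma Zmx_monotone (R : realType) n (A : 'M[R]_n) (p v : 'cV[R]_n) :
  (forall i j, i != j -> A i j <= 0) -> lt_mx 0 p -> lt_mx 0 (A *m p) ->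
  le_mx 0 (A *m v) -> le_mx 0 v.
Proof.
move=> Z p0 Ap0 Av0 i0 j; rewrite (ord1 j) mxE leNgt; apply/negP => vi0.
have {}p0 i : 0 < p i 0 by have := p0 i 0; rewrite mxE.
have [i _ minv] := @arg_minP _ _ _ i0 predT (fun i => v i 0 / p i 0) isT.
set c := v i 0 / p i 0 in minv.
have c0 : c < 0.
  by apply: le_lt_trans (minv i0 isT) _; rewrite pmulr_llt0 // invr_gt0.
have : 0 < (A *m (v - c *: p)) i 0.
  have := Av0 i 0; have := Ap0 i 0.
  have -> : (A *m (v - c *: p)) i 0 = (A *m v) i 0 - c * (A *m p) i 0.
    by rewrite mulmxBr -scalemxAr mxDE mxNE [(c *: (A *m p)) i 0]mxE.
  rewrite !mx0E.
  move: ((A *m p) i 0) ((A *m v) i 0) => a b a0 b0; nra.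
rewrite mxE ltNge => /negP; apply; rewrite sumr_le0 // => k _; rewrite !mxE.
have [<-|ik] := eqVneq i k; first by rewrite divfK ?subrr ?mulr0 ?gt_eqF.
by rewrite mulr_le0_ge0 ?Z // subr_ge0 -ler_pdivlMr // minv.
Qed.

Lemma Zmx_monotone_strict (R : realType) n (A : 'M[R]_n) (p v : 'cV[R]_n) :
  (forall i j, i != j -> A i j <= 0) -> lt_mx 0 p -> lt_mx 0 (A *m p) ->
  lt_mx 0 (A *m v) -> lt_mx 0 v.
Proof.
move=> Z p0 Ap0 Av0 i j; have v0 : le_mx 0 v.
  by apply: Zmx_monotone Z p0 Ap0 _ => k l; exact/ltW/Av0.
rewrite lt_neqAle v0 andbT (ord1 j) mxE; apply/eqP => vi0.
have := Av0 i 0; rewrite !mxE ltNge => /negP; apply.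
rewrite sumr_le0 // => k _.
have [<-|ik] := eqVneq i k; first by rewrite -vi0 mulr0.
by rewrite mulr_le0_ge0 ?Z //; have := v0 k 0; rewrite mxE.
Qed.

(** Monotonicity, applied to a kernel vector and to its opposite, shows that
    the kernel is trivial. *)
Lemma Zmx_unit (R : realType) n (A : 'M[R]_n) (p : 'cV[R]_n) :
  (forall i j, i != j -> A i j <= 0) -> lt_mx 0 p -> lt_mx 0 (A *m p) ->
  A \in unitmx.
Proof.
move=> Z p0 Ap0; rewrite -unitmx_tr -row_free_unit -kermx_eq0.
apply/eqP/row_matrixP => i; rewrite row0.
set w := row i (kermx A^T).
have Aw : A *m w^T = 0.
  by rewrite -[A]trmxK -trmx_mul -row_mul mulmx_ker row0 trmx0.
have w1 : le_mx 0 w^T.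
  by apply: Zmx_monotone Z p0 Ap0 _; rewrite Aw => k l; exact: lexx.
have w2 : le_mx 0 (- w^T).
  by apply: Zmx_monotone Z p0 Ap0 _; rewrite mulmxN Aw oppr0 => k l; exact: lexx.
apply/rowP => j; have := w1 j 0; have := w2 j 0.
rewrite !mx0E mxNE !mxE => ? ?.
by apply/eqP; rewrite eq_le -oppr_ge0; apply/andP.
Qed.

(** * The selected edges *)

(** A negative minimum comes from an actual entry rather than from the neutral
    value 0, so in particular the vector has an entry. *)
Lemma first_argmin_exists (R : realType) k (v : 'cV[R]_k) :
  min_entry0 v < 0 ->
  exists2 a, v a 0 < 0 & forall b, first_argmin v b = (b == a).
Proof.
move=> vmin.
have [b0 vb0] : exists b, v b 0 < 0.
  apply: contrapT => /forallNP nv; move: vmin; apply/negP; rewrite -leNgt.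
  by apply/bigmin_geP; split=> // b _; rewrite leNgt; apply/negP.
have [a1 _ a1min] := @arg_minP _ _ _ b0 predT (fun b => v b 0) isT.
have a1P : [forall b, v a1 0 <= v b 0] by apply/forallP => b; exact: a1min.
pose P := [pred a | [forall b, v a 0 <= v b 0]].
have [a /= /forallP amin afirst] := @arg_minnP _ a1 P val a1P.
exists a => [|b]; first exact: le_lt_trans (amin b0) vb0.
apply/andP/eqP => [[bmin /forallP bfirst]|->].
  apply/val_inj/eqP; rewrite eqn_leq (afirst b bmin) andbT leqNgt.
  apply/negP => ab; have := bfirst a; rewrite ab /= => va.
  by have := le_lt_trans (amin b) va; rewrite ltxx.
split; first exact/forallP.
apply/forallP => c; apply/implyP => ca; rewrite ltNge; apply/negP => vca.
have /afirst : P c by apply/forallP => d; exact: le_trans vca (amin d).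
by rewrite leqNgt ca.
Qed.

(** K is known through the selected edges only: multiplying a row of blocks by
    K picks one column of each block. *)
Lemma mxrow_mul_Kmat (R : realType) n (E : 'I_n -> {set 'I_n.+1})
    (r : 'cV[R]_(nedges E)) p (sel : forall i, 'I_#|E i|) m
    (C : forall i, 'M[R]_(m, #|E i|)) :
  (forall i a, first_argmin (reduced_cost r p i) a = (a == sel i)) ->
  (\mxrow_i C i) *m Kmat r p = \matrix_(k, b) C b k (sel b).
Proof.
move=> selP; rewrite mul_mxrow_mxcol; apply/matrixP => k b.
rewrite summxE mxE (bigD1 b) //= big1 ?addr0 => [|i ib].
  rewrite mxE (bigD1 (sel b)) //= big1 ?addr0 => [|a asel].
    by rewrite mxE selP !eqxx mulr1.
  by rewrite mxE selP (negbTE asel) mulr0.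
rewrite mxE big1 // => a _.
by rewrite mxE [b == i]eq_sym (negbTE ib) andbF mulr0.
Qed.

Lemma blk_Kmat (R : realType) n (E : 'I_n -> {set 'I_n.+1})
    (r : 'cV[R]_(nedges E)) p (x : 'cV[R]_n) i a :
  blk (Kmat r p *m x) i a 0
  = (first_argmin (reduced_cost r p i) a)%:R * x i 0.
Proof.
rewrite /blk /Kmat mxcol_mul mxcolK mxE (bigD1 i) //= big1 => [|j ji].
  by rewrite mxE eqxx andbT addr0.
by rewrite mxE (negbTE ji) andbF mul0r.
Qed.

Lemma Kmat_ge0 (R : realType) n (E : 'I_n -> {set 'I_n.+1})
    (r : 'cV[R]_(nedges E)) p : le_mx 0 (Kmat r p).
Proof. by move=> i j; rewrite !mxE. Qed.

Lemma sum_blk_Kmat (R : realType) n (E : 'I_n -> {set 'I_n.+1})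
    (r : 'cV[R]_(nedges E)) p (sel : forall i, 'I_#|E i|) (x : 'cV[R]_n) i :
  (forall i a, first_argmin (reduced_cost r p i) a = (a == sel i)) ->
  dot (const_mx 1) (blk (Kmat r p *m x) i) = x i 0.
Proof.
move=> selP; rewrite dotE (bigD1 (sel i)) //= big1 => [|a asel].
  by rewrite blk_Kmat selP eqxx mxE !mul1r addr0.
by rewrite blk_Kmat selP (negbTE asel) mul0r mulr0.
Qed.

Lemma BK_E (R : realType) n (E : 'I_n -> {set 'I_n.+1})
    (r : 'cV[R]_(nedges E)) p (sel : forall i, 'I_#|E i|) k b :
  (forall i a, first_argmin (reduced_cost r p i) a = (a == sel i)) ->
  (Bmat R E *m Kmat r p) k b
  = (enum_val (sel b) == inV k)%:R - (k == b)%:R.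
Proof. by move=> selP; rewrite (mxrow_mul_Kmat _ selP) !mxE. Qed.

(** Multiplication by K^T keeps only the selected edges of r and of B^T p.
    Through this identity the sign of the minimal reduced cost becomes a bound
    on (BK)^T p. *)
Lemma reduced_cost_sel (R : realType) n (E : 'I_n -> {set 'I_n.+1})
    (r : 'cV[R]_(nedges E)) p (sel : forall i, 'I_#|E i|) i :
  (forall i a, first_argmin (reduced_cost r p i) a = (a == sel i)) ->
  reduced_cost r p i (sel i) 0
  = ((Kmat r p)^T *m r + (Bmat R E *m Kmat r p)^T *m p) i 0.
Proof.
move=> selP; have rE : r^T = \mxrow_i (blk r i)^T.
  by rewrite -tr_mxcol submxcolK.
have KTr : ((Kmat r p)^T *m r) i 0 = blk r i (sel i) 0.
  transitivity ((r^T *m Kmat r p) 0 i).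
    by rewrite -[r^T *m _]trmxK trmx_mul trmxK [RHS]mxE.
  by rewrite rE (mxrow_mul_Kmat _ selP) mxE [LHS]mxE.
rewrite /reduced_cost mxE [RHS]mxE KTr; congr (_ + _).
rewrite [LHS]mxE [RHS]mxE; apply: eq_bigr => k _; congr (_ * _).
by rewrite [LHS]mxE [RHS]mxE (mxrow_mul_Kmat _ selP) [RHS]mxE.
Qed.

(** * The closed loop and its cost *)

(** Off the diagonal the closed-loop matrix 1 + BK Lambda collects inflows; on
    the diagonal it is at least 1 - lambda_i, the fraction that stays. *)
Lemma closed_loop_ge0 (R : realType) n (E : 'I_n -> {set 'I_n.+1})
    (r : 'cV[R]_(nedges E)) p (sel : forall i, 'I_#|E i|) (lam x : 'cV[R]_n) :
  (forall i a, first_argmin (reduced_cost r p i) a = (a == sel i)) ->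
  lt_mx 0 lam -> le_mx lam (const_mx 1) -> le_mx 0 x ->
  le_mx 0 (x + Bmat R E *m (Kmat r p *m (diagc lam *m x))).
Proof.
move=> selP lam0 lam1 x0.
have -> : x + Bmat R E *m (Kmat r p *m (diagc lam *m x))
          = (1%:M + Bmat R E *m Kmat r p *m diagc lam) *m x.
  by rewrite mulmxDl mul1mx !mulmxA.
apply: mulmx_ge0 => // i j.
have := lam0 j 0; have := lam1 j 0.
rewrite /diagc mul_mx_diag mx0E.
rewrite mxDE [(\matrix_(_, _) _) i j]mxE (BK_E _ _ selP) !mxE.
case: (i == j) => /=; case: (_ == _) => /=; lra.
Qed.

Lemma closed_loop_Xbox (R : realType) n (E : 'I_n -> {set 'I_n.+1})
    (r : 'cV[R]_(nedges E)) p (sel : forall i, 'I_#|E i|)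
    (lam xbar x : 'cV[R]_n) (ubar : 'cV[R]_(nedges E)) :
  (forall i a, first_argmin (reduced_cost r p i) a = (a == sel i)) ->
  Lset xbar ubar (Kmat r p) lam -> Xbox xbar x ->
  Xbox xbar (x + Bmat R E *m (Kmat r p *m (diagc lam *m x))).
Proof.
move=> selP [lam0 lam1 _ BKle0] [x0 xle]; split.
  exact: closed_loop_ge0 selP lam0 lam1 x0.
(* The closed loop preserves the order, so the gap xbar - x stays
   nonnegative and it remains to compare the image of xbar with xbar. *)
have gap0 : le_mx 0 (xbar - x).
  by move=> i j; rewrite !mxE subr_ge0; exact: xle.
have step := closed_loop_ge0 selP lam0 lam1 gap0.
move=> i j; have := BKle0 i j; have := step i j.
rewrite !mulmxBr !mulmxA.
by rewrite !(mxDE, mxNE, mx0E); lra.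
Qed.

Lemma feedback_Uadm (R : realType) n (E : 'I_n -> {set 'I_n.+1})
    (r : 'cV[R]_(nedges E)) p (sel : forall i, 'I_#|E i|)
    (lam xbar x : 'cV[R]_n) (ubar : 'cV[R]_(nedges E)) :
  (forall i a, first_argmin (reduced_cost r p i) a = (a == sel i)) ->
  Lset xbar ubar (Kmat r p) lam -> Xbox xbar x ->
  Uadm ubar x (Kmat r p *m (diagc lam *m x)).
Proof.
move=> selP [lam0 lam1 Kle _] [x0 xle].
have x0' i : 0 <= x i 0 by have := x0 i 0; rewrite mxE.
have lam0' i : 0 < lam i 0 by have := lam0 i 0; rewrite mxE.
have u0 : le_mx 0 (Kmat r p *m (diagc lam *m x)).
  apply: mulmx_ge0; first exact: Kmat_ge0.
  by move=> i j; rewrite (ord1 j) diagcE mxE mulr_ge0 // ltW.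
split; split=> //.
  move=> i; rewrite (sum_blk_Kmat _ _ selP) diagcE ler_piMl //.
  by have := lam1 i 0; rewrite mxE.
apply: le_mx_trans Kle; rewrite -mulmxA; apply: mulmx_le; first exact: Kmat_ge0.
by move=> i j; rewrite (ord1 j) !diagcE ler_wpM2l ?xle // ltW.
Qed.

(** phat solves a linear Lyapunov equation whose right-hand side is scaled by
    Lambda^-1, which cancels the Lambda of the feedback: the cost of a step is
    then an exact difference. *)
Lemma phat_decrease (R : realType) n k (B : 'M[R]_(n, k)) (K : 'M[R]_(k, n))
    (lam s q x : 'cV[R]_n) (r : 'cV[R]_k) :
  lt_mx 0 lam ->
  - (B *m K)^T *m q = invmx (diagc lam) *m s + K^T *m r ->
  dot s x + dot r (K *m (diagc lam *m x))
  = dot q x - dot q (x + B *m (K *m (diagc lam *m x))).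
Proof.
move=> lam0 qE; rewrite dotDr opprD addNKr.
have -> : - dot q (B *m (K *m (diagc lam *m x)))
          = dot (- (B *m K)^T *m q) (diagc lam *m x).
  by rewrite mulmxA dot_mulmx /dot mulNmx linearN mulNmx !mxE.
rewrite qE dotDl; congr (_ + _); last exact: dot_mulmx.
by rewrite dot_mulmx /diagc tr_diag_mx mulKVmx // diagc_unit.
Qed.

Lemma J_telescope (R : realType) n (E : 'I_n -> {set 'I_n.+1})
    (s q x : 'cV[R]_n) (r : 'cV[R]_(nedges E)) N u :
  (forall t, stage_cost s r (traj u x t) (u t)
             = dot q (traj u x t) - dot q (traj u x t.+1)) ->
  J s r N x u = dot q x - dot q (traj u x N).
Proof.
move=> step; rewrite /J.
elim: N => [|N IH]; first by rewrite big_geq // subrr.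
by rewrite big_nat_recr //= IH step /=; ring.
Qed.

Lemma le_max_entry (R : realType) k (v : 'cV[R]_k.+1) i :
  v i 0 <= max_entry v.
Proof. exact: (le_bigmax _ (fun c => v c 0)). Qed.

Lemma dot_le_max_ratio (R : realType) n (q s x : 'cV[R]_n.+1) :
  lt_mx 0 s -> le_mx 0 x ->
  dot q x <= max_entry (\col_i (q i 0 / s i 0)) * dot s x.
Proof.
move=> s0 x0; rewrite !dotE mulr_sumr ler_sum // => i _; rewrite mulrA.
have si0 : 0 < s i 0 by have := s0 i 0; rewrite mxE.
apply: ler_wpM2r; first by have := x0 i 0; rewrite mxE.
rewrite -ler_pdivrMr //.
by have := le_max_entry (\col_i (q i 0 / s i 0)) i; rewrite mxE.
Qed.

Theorem proposition2 (R : realType) (n : nat)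
    (E : 'I_n.+1 -> {set 'I_n.+2}) (E_no_loops : no_loops E)
    (xbar : 'cV[R]_n.+1) (xbar_gt0 : lt_mx 0 xbar)
    (ubar : 'cV[R]_(nedges E)) (ubar_gt0 : lt_mx 0 ubar)
    (s : 'cV[R]_n.+1) (s_gt0 : lt_mx 0 s)
    (r : 'cV[R]_(nedges E)) (r_ge0 : le_mx 0 r)
    (p : 'cV[R]_n.+1) (p_gt0 : lt_mx 0 p) (p_cond : p_condition s r p)
    (lambda : 'cV[R]_n.+1) (lambda_L : Lset xbar ubar (Kmat r p) lambda) :
  let K := Kmat r p in
  let BK := Bmat R E *m K in
  let Lambda := diagc lambda in
  let phat := - ((invmx BK)^T *m (invmx Lambda *m s + K^T *m r)) in
  let gamma := max_entry (\col_i (phat i 0 / s i 0)) in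
  [/\ BK \in unitmx, lt_mx 0 phat, 0 < gamma &
      forall (N : nat) (x : 'cV[R]_n.+1), (0 < N)%N -> Xbox xbar x ->
        (V xbar ubar s r N x <= (gamma * dot s x)%:E)%E].
Proof.
move=> K BK Lambda phat gamma.
have s0 i : 0 < s i 0 by have := s_gt0 i 0; rewrite mxE.
have [lam_gt0 lam_le1 _ _] := lambda_L.
have lam0 i : 0 < lambda i 0 by have := lam_gt0 i 0; rewrite mxE.
have min_lt0 i : min_entry0 (reduced_cost r p i) < 0.
  have /matrixP/(_ i 0) := p_cond; rewrite !mxE summxE (bigD1 i) //= big1.
    by rewrite !mxE !eqxx mulr1; have := s0 i; lra.
  by move=> j ji; rewrite !mxE eq_sym (negbTE ji) mulr0.
pose sel i := s2val (cid2 (first_argmin_exists (min_lt0 i))).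
have selP i a : first_argmin (reduced_cost r p i) a = (a == sel i).
  exact: (s2valP' (cid2 (first_argmin_exists (min_lt0 i)))).
have sel_lt0 i : reduced_cost r p i (sel i) 0 < 0.
  exact: (s2valP (cid2 (first_argmin_exists (min_lt0 i)))).
have KTr0 : le_mx 0 (K^T *m r).
  apply: mulmx_ge0 => // i j; rewrite [K^T _ _]mxE mx0E.
  by have := Kmat_ge0 r p j i; rewrite mx0E.
have Z i j : i != j -> (- BK^T) i j <= 0.
  rewrite eq_sym => /negbTE ij; rewrite mxNE [BK^T i j]mxE (BK_E _ _ selP) ij subr0.
  by rewrite oppr_le0 ler0n.
have Ap0 : lt_mx 0 (- BK^T *m p).
  move=> i j; rewrite (ord1 j); have := sel_lt0 i; have := KTr0 i 0.
  rewrite (reduced_cost_sel _ selP) -/K -/BK mulNmx.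
  by rewrite mxNE mxDE !mx0E; lra.
have BK_unit : BK \in unitmx.
  have := Zmx_unit Z p_gt0 Ap0.
  by rewrite -linearN unitmx_tr -scaleN1r unitmxZ // unitrN1.
have phatE : - BK^T *m phat = invmx Lambda *m s + K^T *m r.
  by rewrite mulNmx mulmxN opprK mulmxA -trmx_mul mulVmx // trmx1 mul1mx.
have w0 i : 0 < (invmx Lambda *m s) i 0.
  have := s0 i; rewrite -{1}(mulKVmx (diagc_unit lam_gt0) s) diagcE.
  by rewrite pmulr_rgt0.
have phat_gt0 : lt_mx 0 phat.
  apply: Zmx_monotone_strict Z p_gt0 Ap0 _; rewrite phatE => i j.
  rewrite (ord1 j); have := w0 i; have := KTr0 i 0.
  by rewrite !mx0E mxDE; lra.
split=> // [|N x _ xX].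
  apply: lt_le_trans (le_max_entry _ 0); rewrite mxE divr_gt0 //.
  by have := phat_gt0 0 0; rewrite mxE.
pose F (y : 'cV[R]_n.+1) := K *m (Lambda *m y).
pose u t := F (iter t (fun y => y + Bmat R E *m F y) x).
have trajE t : traj u x t = iter t (fun y => y + Bmat R E *m F y) x.
  by elim: t => //= t ->.
have trajX t : Xbox xbar (traj u x t).
  elim: t => // t IH; rewrite trajE iterS -trajE.
  exact: closed_loop_Xbox selP lambda_L IH.
have uUN : UN xbar ubar N x u.
  split=> // t _; split=> //; rewrite [u t]/u -trajE.
  exact: feedback_Uadm selP lambda_L _.
apply: (@le_trans _ _ (J s r N x u)%:E).
  by apply: ereal_inf_lbound; exists u.
rewrite lee_fin (@J_telescope _ _ _ s phat) => [|t]; last first.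
  rewrite [traj u x t.+1]/= /stage_cost [u t]/u -trajE.
  exact: phat_decrease lam_gt0 phatE.
apply: le_trans (dot_le_max_ratio phat s_gt0 xX.1).
rewrite lerBlDr lerDl dotE sumr_ge0 // => i _; rewrite mulr_ge0 //.
  by have := phat_gt0 i 0; rewrite mxE => /ltW.
by have := (trajX N).1 i 0; rewrite mxE.
Qed.
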